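(* For every (finite, simple) graph $F$ there exists $k_0=k_0(F)$ such that for every integer $k \ge k_0$ the graph $H$ obtained from $F$ by adding $k$ isolated vertices satisfies $f_\ell(H)=\mathsf{v}(H)-1$. In fact, every $H$-minor-free graph is $(\mathsf{v}(H)-2)$-degenerate.
   Context: All graphs are finite, without loops or parallel edges. $\mathsf{v}(G)$ denotes the number of vertices of $G$. A graph $G$ contains $H$ as a minor if a graph isomorphic to $H$ can be obtained from a subgraph of $G$ by contracting edges; $G$ is $H$-minor-free otherwise. For a graph $H$, $f_\ell(H)$ denotes the maximum list chromatic number (choice number) $\chi_\ell(G)$ over all $H$-minor-free graphs $G$. A graph is $a$-degenerate if every nonempty subgraph has a vertex of degree at most $a$. *)

(* Defs.v *)
From HB Require Import structures.
From mathcomp Require Import all_boot.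
From mathcomp Require Import boolp.

Set Implicit Arguments.
Unset Strict Implicit.
Unset Printing Implicit Defensive.

Record sgraph := SGraph {
  vertex :> finType;
  adj : rel vertex;
  adj_sym : symmetric adj;
  adj_irr : irreflexive adj }.

Definition degree (G : sgraph) (x : G) : nat := #|[set y : G | adj x y]|.

Definition isomorphic (G H : sgraph) : Prop :=
  exists f : G -> H, bijective f /\ forall x y, adj (f x) (f y) = adj x y.

(* S is, up to isomorphism, a (not necessarily induced) subgraph of G. *)
Definition subgraph (S G : sgraph) : Prop :=
  exists f : S -> G, injective f /\ forall x y, adj x y -> adj (f x) (f y).

(* Contraction of the edge xy: y is deleted and x, which now stands for the
   merged vertex, inherits the neighbours of y; loops and parallel edges
   disappear. *)
Section Contraction.
Variables (G : sgraph) (x y : G).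

Definition contract_vertex : finType := {z : G | z != y}.

Definition contract_adj : rel contract_vertex := fun a b =>
  (a != b) &&
  [|| adj (val a) (val b),
      (val a == x) && adj y (val b) |
      (val b == x) && adj y (val a)].

Lemma contract_adj_sym : symmetric contract_adj.
Proof.
by move=> a b; rewrite /contract_adj eq_sym adj_sym; congr (_ && (_ || _)); rewrite orbC.
Qed.

Lemma contract_adj_irr : irreflexive contract_adj.
Proof. by move=> a; rewrite /contract_adj eqxx. Qed.

Definition contract : sgraph := SGraph contract_adj_sym contract_adj_irr.
End Contraction.

Inductive contracts_to : sgraph -> sgraph -> Prop :=
| contracts_refl G : contracts_to G G
| contracts_step (G : sgraph) (x y : G) (K : sgraph) :
    adj x y -> contracts_to (contract x y) K -> contracts_to G K.

Definition has_minor (G H : sgraph) : Prop :=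
  exists S K : sgraph, [/\ subgraph S G, contracts_to S K & isomorphic K H].

Definition minor_free (H G : sgraph) : Prop := ~ has_minor G H.

Definition degenerate (a : nat) (G : sgraph) : Prop :=
  forall S : sgraph, subgraph S G -> 0 < #|S| -> exists x : S, degree x <= a.

(* The colours range over an arbitrary finite type: since G is finite, only
   finitely many colours occur in any assignment of finite lists. *)
Definition choosable (G : sgraph) (k : nat) : Prop :=
  forall (C : finType) (L : G -> {set C}), (forall x, k <= #|L x|) ->
  exists c : G -> C,
    (forall x, c x \in L x) /\ (forall x y, adj x y -> c x != c y).

Lemma choosable_order (G : sgraph) : choosable G #|G|.
Proof.
move=> C L hL.
have [x0 _|G0] := pickP (mem G); last first.
  have noG : G -> False by move=> x; have := G0 x; rewrite inE.
  by exists (fun x => False_rect C (noG x)); split=> x; case: (noG x).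
have /card_gt0P[a0 _] : 0 < #|L x0|.
  by apply: leq_trans (hL x0); apply/card_gt0P; exists x0.
suff H s : uniq s -> exists c : G -> C,
    {in s, forall x, c x \in L x} /\ {in s &, injective c}.
  have [c [cL ci]] := H _ (enum_uniq (mem G)).
  exists c; split=> [x|x y xy]; first by apply: cL; rewrite mem_enum.
  apply/eqP => /ci; rewrite !mem_enum => /(_ isT isT) exy.
  by rewrite exy adj_irr in xy.
elim: s => [_|v s IHs /= /andP[vs us]]; first by exists (fun=> a0).
have [c [cL ci]] := IHs us.
have [a aL ac] : exists2 a, a \in L v & a \notin [seq c x | x <- s].
  have /subsetPn[a aL ac] : ~~ (L v \subset [seq c x | x <- s]).
    apply/negP => /subset_leq_card.
    apply/negP; rewrite -ltnNge; apply: leq_trans (hL v).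
    apply: leq_ltn_trans (card_size _) _; rewrite size_map.
    have /card_uniqP e : uniq (v :: s) by rewrite /= vs.
    by move: (max_card (mem (v :: s))); rewrite e.
  by exists a.
have cN x : x \in s -> c x <> a.
  by move=> xs cxa; case/negP: ac; rewrite -cxa map_f.
exists (fun x => if x == v then a else c x); split=> [x|x y].
  by rewrite inE; case: eqP => [->|_] //= /cL.
rewrite !inE; case: eqP => [->|_] /=; case: eqP => [->|_] //= xs ys.
- by move=> e; case: (cN y ys).
- by move=> e; case: (cN x xs).
- exact: ci.
Qed.

Lemma choosable_ex (G : sgraph) : exists k, `[< choosable G k >].
Proof. by exists #|G|; apply/asboolP/choosable_order. Qed.

Definition choice_number (G : sgraph) : nat := ex_minn (choosable_ex G).

(* "f_l(H) = m": the maximum of the choice numbers of the H-minor-free graphs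
   exists and equals m. *)
Definition max_choice_number (H : sgraph) (m : nat) : Prop :=
  (exists G : sgraph, minor_free H G /\ choice_number G = m) /\
  (forall G : sgraph, minor_free H G -> choice_number G <= m).

Section AddIsolated.
Variables (F : sgraph) (k : nat).

Definition add_isolated_adj : rel (F + 'I_k)%type := fun u v =>
  match u, v with inl x, inl y => adj x y | _, _ => false end.

Lemma add_isolated_adj_sym : symmetric add_isolated_adj.
Proof. by move=> [x|i] [y|j] //=; rewrite adj_sym. Qed.

Lemma add_isolated_adj_irr : irreflexive add_isolated_adj.
Proof. by move=> [x|i] //=; rewrite adj_irr. Qed.

Definition add_isolated : sgraph :=
  SGraph add_isolated_adj_sym add_isolated_adj_irr.
End AddIsolated.

(* Main.v *)
Require Import Defs.
From mathcomp Require Import all_boot.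
From mathcomp Require Import boolp zify.

Set Implicit Arguments.
Unset Strict Implicit.
Unset Printing Implicit Defensive.

(* Write n = v(F) and let G have minimum degree at least n + k - 1, so that
   v(G) = k + m with m >= n.  It suffices to find a K_n minor of G supported on
   at most m vertices: the other k vertices serve as isolated ones.  If m is
   bounded in terms of n, the complement of G has bounded maximum degree, and a
   greedy choice gives a clique on n vertices once k is large.  If m and k are
   both large, deleting vertices of minimum degree leaves m vertices spanning a
   graph with edge density at least that of G, hence with average degree about
   km / (k + m) at least; this exceeds 2^(n+1), which forces a K_n minor (Mader).
   For the value of f_l, degeneracy bounds the choice number by greedy colouring
   and the complete graph on v(H) - 1 vertices is extremal. *)

(** * Minor models *)

(* [phi] encodes a family of disjoint branch sets: the branch set of [h] is the
   fibre of [phi] over [Some h].  Connectedness of a branch set is expressed by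
   the existence of an edge across each of its nontrivial cuts [B]. *)
Definition minor_map (G H : sgraph) (phi : G -> option H) : Prop :=
  [/\ forall h, exists x, phi x = Some h,
      forall h (B : pred G),
        (exists2 x, phi x = Some h & B x) ->
        (exists2 y, phi y = Some h & ~~ B y) ->
        exists u v, [/\ phi u = Some h, phi v = Some h, B u, ~~ B v & adj u v] &
      forall h h', adj h h' ->
        exists u v, [/\ phi u = Some h, phi v = Some h' & adj u v]].

(** A cut [B] of a composite branch set either splits some branch set of [phi], which then supplies
    the crossing edge, or is constant on each of them and descends to a cut [B'] of a branch set of
    [psi]. *)
Lemma minor_map_comp (G H K : sgraph) (phi : G -> option H) (psi : H -> option K) :
  minor_map phi -> minor_map psi -> minor_map (fun x => obind psi (phi x)).
Proof.
move=> [sG cG eG] [sH cH eH]; split.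
- by move=> k; have [h hk] := sH k; have [x xh] := sG h; exists x; rewrite xh.
- move=> k B [x xk Bx] [y yk By].
  case xh: (phi x) xk => [h|//] /= hk; case yh: (phi y) yk => [h'|//] /= hk'.
  have [/existsP[[u v] /and5P[/eqP /= uv nu ku Bu Bv]]|nocut] :=
    boolP [exists p : G * G, [&& phi p.1 == phi p.2, phi p.1 != None,
      obind psi (phi p.1) == Some k, B p.1 & ~~ B p.2]].
    case E: (phi u) uv nu ku => [g|//] uv _ /eqP /= ku.
    have [|| a [b [ag bg Ba Bb ab]]] := cG g B; [by exists u | by exists v |].
    by exists a, b; rewrite ag bg /=.
  have {}nocut u v g : phi u = Some g -> phi v = Some g -> psi g = Some k ->
      B u -> B v.
    move=> ug vg gk Bu; apply: contraNT nocut => Bv; apply/existsP; exists (u, v).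
    by rewrite /= ug vg /= gk !eqxx Bu Bv.
  pose B' (g : H) := [exists z, (phi z == Some g) && B z].
  have [|| g [g' [gk gk' Bg Bg' gg]]] := cH k B'.
  + by exists h => //; apply/existsP; exists x; rewrite xh eqxx.
  + exists h' => //; apply/existsPn => z; apply/negP => /andP[/eqP zh Bz].
    by move: By; rewrite (nocut _ _ _ zh yh hk' Bz).
  have [u [v [ug vg uv]]] := eG _ _ gg.
  exists u, v; rewrite ug vg /=; split=> //.
  + by have /existsP[z /andP[/eqP zg Bz]] := Bg; apply: nocut zg ug gk Bz.
  + by apply: contraNN Bg' => Bv; apply/existsP; exists v; rewrite vg eqxx.
- move=> k k' kk; have [h [h' [hk hk' hh]]] := eH _ _ kk.
  have [u [v [uh vh uv]]] := eG _ _ hh.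
  by exists u, v; rewrite uh vh.
Qed.

(** * Edge contraction, and the passage from models to minors *)

Lemma adj_neq (K : sgraph) (u v : K) : adj u v -> u != v.
Proof. by apply: contraTneq => ->; rewrite adj_irr. Qed.

Section ContractionMap.
Variables (G : sgraph) (x y : G).
Hypothesis xy : adj x y.

(** The quotient map of the contraction: only [y] lies outside the subtype, and the default value of
    [insubd] sends it to [x]. *)
Definition contract_proj (z : G) : contract x y := insubd (exist _ x (adj_neq xy)) z.

Lemma val_contract_proj z : val (contract_proj z) = if z == y then x else z.
Proof. by rewrite val_insubd; case: eqP. Qed.

Lemma contract_projK (a : contract x y) : contract_proj (val a) = a.
Proof. by apply: val_inj; rewrite val_contract_proj (negPf (valP a)). Qed.

Lemma contract_proj_eq u v : contract_proj u = contract_proj v ->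
  [|| u == v, (u == x) && (v == y) | (u == y) && (v == x)].
Proof.
move/(congr1 val); rewrite !val_contract_proj.
case: (eqVneq u y) => [->|uy]; case: (eqVneq v y) => [->|vy] //.
- by move=> <-; rewrite !eqxx !orbT.
- by move=> ->; rewrite !eqxx orbT.
- by move=> ->; rewrite eqxx.
Qed.

Lemma adj_contract_proj u v : adj u v -> contract_proj u != contract_proj v ->
  adj (contract_proj u) (contract_proj v).
Proof.
move=> uv uv'; rewrite /= /contract_adj uv' /= !val_contract_proj.
case: (eqVneq u y) uv uv' => [->|uy]; case: (eqVneq v y) => [->|vy].
- by rewrite adj_irr.
- by rewrite eqxx => ->; rewrite orbT.
- by rewrite (adj_sym u) eqxx => ->; rewrite !orbT.
- by move=> ->.
Qed.

Lemma card_contract : #|contract x y|.+1 = #|G|.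
Proof.
by rewrite card_sig [X in X.+1](_ : _ = #|predC1 y|) ?cardC1 ?prednK //;
  first (by apply/card_gt0P; exists y); apply: eq_card.
Qed.

Lemma minor_map_contract : minor_map (fun z => Some (contract_proj z)).
Proof.
split.
- by move=> h; exists (val h); rewrite contract_projK.
- move=> h B [u [uh] Bu] [v [vh] Bv].
  have := contract_proj_eq (etrans uh (esym vh)).
  case/or3P => [/eqP uv|/andP[/eqP ux /eqP vy]|/andP[/eqP uy /eqP vx]].
  + by move: Bv; rewrite -uv Bu.
  + by exists u, v; rewrite uh vh; split=> //; rewrite ux vy.
  + by exists u, v; rewrite uh vh; split=> //; rewrite uy vx adj_sym.
- move=> a b /andP[ab].
  case/or3P => [h|/andP[/eqP ax h]|/andP[/eqP bx h]].
  + by exists (val a), (val b); rewrite !contract_projK.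
  + exists y, (val b); rewrite contract_projK; split=> //.
    by congr Some; apply: val_inj; rewrite val_contract_proj eqxx ax.
  + exists (val a), y; rewrite contract_projK adj_sym; split=> //.
    by congr Some; apply: val_inj; rewrite val_contract_proj eqxx bx.
Qed.

End ContractionMap.

(** Induction on [#|S|]: an injective [psi] is an isomorphism; otherwise some fibre has two
    vertices, its connectedness gives an edge inside it, and [psi] factors through the contraction
    of that edge. The second hypothesis ensures that the final graph has no edges beyond those of
    [H]. *)
Lemma contract_to_minor (H S : sgraph) (psi : S -> H) :
  minor_map (fun s => Some (psi s)) ->
  (forall s t, adj s t -> psi s != psi t -> adj (psi s) (psi t)) ->
  exists2 K, contracts_to S K & isomorphic K H.
Proof.
have [n] := ubnP #|S|; elim: n => // n IHn in S psi * => ltn [sS cS eS] aS.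
have [/injectiveP inj|/injectivePn[s [t st pst]]] := boolP (injectiveb psi).
  exists S; [exact: contracts_refl | exists psi; split].
    apply: inj_card_bij => //.
    rewrite -(card_codom inj); apply/subset_leq_card/subsetP => h _.
    by have [u [<-]] := sS h; apply: codom_f.
  move=> s t; apply/idP/idP => [/eS[u [v [[us] [vt] uv]]]|st].
    by rewrite -(inj _ _ us) -(inj _ _ vt).
  by apply: aS => //; rewrite inj_eq // adj_neq.
have [|| x [y [[xp] [yp] _ _ xy]]] := cS (psi s) (pred1 s).
- by exists s => //=.
- by exists t; rewrite ?pst //= eq_sym.
pose r := contract_proj xy.
pose psi' (a : contract x y) := psi (val a).
have rp z : psi' (r z) = psi z.
  by rewrite /psi' val_contract_proj; case: eqP => // ->; rewrite xp yp.
case: (@IHn (contract x y) psi').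
- by rewrite -ltnS card_contract.
- split=> [h|h B [a [ah] Ba] [b [bh] Bb]|h h' hh].
  + by have [u [uh]] := sS h; exists (r u); rewrite rp uh.
  + have [|| u [v [[uh] [vh] Bu Bv uv]]] := cS h (B \o r).
    * by exists (val a); [congr Some | rewrite /= /r contract_projK].
    * by exists (val b); [congr Some | rewrite /= /r contract_projK].
    exists (r u), (r v); rewrite !rp uh vh; split=> //.
    by apply: adj_contract_proj => //; apply: contraNneq Bv; rewrite /= -/(r u) -/(r v) => <-.
  + have [u [v [[uh] [vh] uv]]] := eS _ _ hh.
    exists (r u), (r v); rewrite !rp uh vh; split=> //.
    apply: adj_contract_proj => //; apply: contraTneq hh.
    by move/(congr1 psi'); rewrite !rp uh vh => ->; rewrite adj_irr.
- move=> a b /andP[_ /or3P[ab|/andP[/eqP ax yb]|/andP[/eqP bx ya]]] ne.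
  + exact: aS.
  + by move: ne; rewrite /psi' ax xp -yp; apply: aS.
  + move: ne; rewrite /psi' bx xp -yp (adj_sym (psi _)) eq_sym; exact: aS.
by move=> K SK KH; exists K => //; apply: contracts_step SK.
Qed.

(** The subgraph [S] keeps only the vertices covered by [phi], and the edges inside a branch set or
    above an edge of [H]; this secures the edge condition of [contract_to_minor]. *)
Lemma has_minor_of_map (G H : sgraph) (phi : G -> option H) :
  minor_map phi -> has_minor G H.
Proof.
move=> [sG cG eG].
pose T : finType := {x : G | phi x}.
pose e : rel T := fun a b => adj (val a) (val b) &&
  ((phi (val a) == phi (val b)) ||
   if phi (val a) is Some h then
     if phi (val b) is Some h' then adj h h' else false else false).
have es : symmetric e.
  move=> a b; rewrite /e adj_sym eq_sym; congr (_ && (_ || _)).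
  by case: (phi _) => [h|]; case: (phi _) => [h'|] //; rewrite adj_sym.
have ei : irreflexive e by move=> a; rewrite /e adj_irr.
pose S := SGraph es ei.
have some (a : S) : exists h, phi (val a) == Some h.
  by have := valP a; case: (phi _) => // h _; exists h.
pose psi a := xchoose (some a).
have psiE a : phi (val a) = Some (psi a) by apply/eqP/(xchooseP (some a)).
have lift u h : phi u = Some h -> exists2 a : S, val a = u & psi a = h.
  move=> uh; have pu : phi u by rewrite uh.
  exists (exist _ u pu) => //.
  by have := psiE (exist _ u pu); rewrite /= uh => -[].
have psiS a b : adj (val a) (val b) -> (psi a == psi b) || adj (psi a) (psi b) ->
    adj (a : S) b.
  by move=> ab; rewrite /= /e ab !psiE (inj_eq Some_inj).
have [|a b|K SK KH] := @contract_to_minor H S psi; last first.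
- exists S, K; split=> //; exists val; split; first exact: val_inj.
  by move=> a b /andP[].
- by rewrite /= /e !psiE (inj_eq Some_inj) => /andP[_ /orP[->|]].
split=> [h|h B [a [ah] Ba] [b [bh] Bb]|h h' hh].
- by have [x /lift[a _ <-]] := sG h; exists a.
- pose B' x := if insub x is Some c then B (c : S) else false.
  have B'E (c : S) : B' (val c) = B c by rewrite /B' valK.
  have [|| u [v [/lift[c <- ch] /lift[d <- dh]]]] := cG h B'.
  + by exists (val a); rewrite ?psiE ?ah ?B'E.
  + by exists (val b); rewrite ?psiE ?bh ?B'E.
  rewrite !B'E => Bc Bd cd; exists c, d; rewrite ch dh; split=> //.
  by apply: psiS => //; rewrite ch dh eqxx.
- have [u [v [/lift[c <- ch] /lift[d <- dh] cd]]] := eG _ _ hh.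
  exists c, d; rewrite ch dh; split=> //.
  by apply: psiS => //; rewrite ch dh hh orbT.
Qed.

(** * Complete minors in dense graphs *)

Section Induced.
Variables (G : sgraph) (W : {set G}).

Definition induced_adj : rel {x : G | x \in W} := fun a b => adj (val a) (val b).

Lemma induced_adj_sym : symmetric induced_adj.
Proof. by move=> a b; apply: adj_sym. Qed.

Lemma induced_adj_irr : irreflexive induced_adj.
Proof. by move=> a; apply: adj_irr. Qed.

Definition induced : sgraph := SGraph induced_adj_sym induced_adj_irr.

Lemma card_induced : #|induced| = #|W|.
Proof. by rewrite card_sig; apply: eq_card. Qed.

Lemma induced_subgraph : subgraph induced G.
Proof. by exists val; split; first exact: val_inj. Qed.

Lemma degree_induced (a : induced) : degree a = #|[set y in W | adj (val a) y]|.
Proof.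
rewrite /degree -(card_imset _ val_inj); apply: eq_card => y; rewrite inE.
apply/imsetP/andP => [[b]|[yW ay]].
  by rewrite inE => ab ->; split=> //; apply: valP.
by exists (exist _ y yW) => //; rewrite inE.
Qed.

Definition induced_map (T : Type) (phi : induced -> option T) (x : G) :=
  obind phi (insub x).

Lemma induced_mapE T (phi : induced -> option T) a : induced_map phi (val a) = phi a.
Proof. by rewrite /induced_map valK. Qed.

Lemma induced_map_some T (phi : induced -> option T) x h :
  induced_map phi x = Some h -> exists2 a, x = val a & phi a = Some h.
Proof. by rewrite /induced_map; case: insubP => // a _ <- ah; exists a. Qed.

End Induced.

Definition complete_adj (n : nat) : rel 'I_n := fun i j => i != j.

Lemma complete_adj_sym n : symmetric (@complete_adj n).
Proof. by move=> i j; rewrite /complete_adj eq_sym. Qed.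

Lemma complete_adj_irr n : irreflexive (@complete_adj n).
Proof. by move=> i; rewrite /complete_adj eqxx. Qed.

Definition complete (n : nat) : sgraph := SGraph (@complete_adj_sym n) (@complete_adj_irr n).

(** Twice the number of edges. *)
Definition narcs (G : sgraph) : nat := \sum_(x : G) degree x.

Lemma narcsE (G : sgraph) : narcs G = #|[set p : G * G | adj p.1 p.2]|.
Proof.
rewrite -sum1_card /narcs (eq_bigl (fun p : G * G => predT p.1 && adj p.1 p.2)).
  rewrite -(pair_big_dep predT (fun x y => adj x y) (fun _ _ => 1)) /=.
  by apply: eq_bigr => x _; rewrite /degree -sum1_card; apply: eq_bigl => y; rewrite inE.
by move=> p; rewrite inE.
Qed.

(** Contracting [xy] destroys the two arcs between [x] and [y] and, for each common neighbour [z],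
    identifies the arcs between [y] and [z] with those between [x] and [z]. Once [Bad] is discarded,
    the projection is injective on arcs. *)
Lemma narcs_contract (G : sgraph) (x y : G) : adj x y ->
  narcs G <= narcs (contract x y) + (#|[set z | adj x z && adj y z]|).+1.*2.
Proof.
move=> xy; rewrite !narcsE.
set T := [set z | _ && _]; set E := [set p : G * G | _]; set E' := [set p | _].
pose Bad := [set (x, y); (y, x)] :|: ([set (y, z) | z in T] :|: [set (z, y) | z in T]).
have cBad : #|Bad| <= #|T|.+1.*2.
  rewrite doubleS -addnn -addn2 addnC.
  apply: leq_trans (leq_card_setU _ _) _; apply: leq_add; first by rewrite cards2; case: eqP.
  by apply: leq_trans (leq_card_setU _ _) _; apply: leq_add; apply: leq_imset_card.
have cE : #|E| <= #|E :\: Bad| + #|Bad|.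
  by rewrite addnC -(cardsID Bad E) leq_add2r subset_leq_card // subsetIr.
apply: leq_trans cE _; apply: leq_add => //.
pose r := contract_proj xy; pose f (p : G * G) := (r p.1, r p.2).
have rC u v : adj u v -> r u = r v -> (u, v) \in Bad.
  move=> uv /contract_proj_eq; rewrite (negPf (adj_neq uv)) /=.
  by case/orP=> /andP[/eqP -> /eqP ->]; rewrite !inE eqxx ?orbT.
have finj : {in E :\: Bad &, injective f}.
  (* Distinct tails with the same image are [x] and [y]. Then either the heads agree and the arc at
     [y] is bad, or the first arc joins [x] and [y] and is bad, or it would be a loop. *)
  have side a b c d : adj a b -> adj c d -> r a = r c -> r b = r d ->
      (a, b) \notin Bad -> (c, d) \notin Bad -> a = c.
    move=> ab cd ac bd nab ncd; apply/eqP; apply: contraNT nab => neac.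
    have := contract_proj_eq ac; rewrite (negPf neac) /=.
    case/orP=> /andP[/eqP ea /eqP ec]; subst a c.
    - have /or3P[/eqP ebd|/andP[/eqP eb _]|/andP[/eqP eb _]] := contract_proj_eq bd.
      + case/negP: ncd; rewrite !inE; apply/orP; right; apply/orP; left.
        by apply/imsetP; exists d; rewrite // inE -ebd ab ebd cd.
      + by rewrite eb adj_irr in ab.
      + by rewrite eb !inE eqxx.
    - have /or3P[/eqP ebd|/andP[/eqP eb _]|/andP[/eqP eb _]] := contract_proj_eq bd.
      + rewrite !inE; apply/orP; right; apply/orP; left.
        by apply/imsetP; exists b; rewrite // inE ab ebd cd.
      + by rewrite eb !inE eqxx orbT.
      + by rewrite eb adj_irr in ab.
  have BadC u v : ((u, v) \in Bad) = ((v, u) \in Bad).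
    wlog suff: u v / (u, v) \in Bad -> (v, u) \in Bad.
      by move=> h; apply/idP/idP; apply: h.
    rewrite !inE !xpair_eqE => /orP[/orP[]/andP[-> ->]|/orP[]/imsetP[z zT [-> ->]]].
    - by rewrite orbT.
    - by [].
    - by rewrite (imset_f (fun z => (z, y)) zT) !orbT.
    - by rewrite (imset_f (fun z => (y, z)) zT) !orbT.
  move=> [a b] [c d] /setDP[]; rewrite inE /= => ab nab /setDP[]; rewrite inE /= => cd ncd [ac bd].
  congr (_, _); first exact: side ab cd ac bd nab ncd.
  by apply: side bd ac _ _; rewrite 1?adj_sym // BadC.
rewrite -(card_in_imset finj); apply/subset_leq_card/subsetP => q /imsetP[[a b]].
case/setDP; rewrite inE /= => ab nab ->; rewrite inE.
by apply: adj_contract_proj => //; apply: contraNneq nab; apply: rC.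
Qed.

(* If no contraction keeps the density, every edge lies in many triangles, so
   the neighbourhood of any vertex is dense enough for the induction on [n]. *)
Lemma complete_minor_map n (G : sgraph) :
  0 < #|G| -> 2 ^ n.+1 * #|G| <= narcs G ->
  exists phi : G -> option (complete n), minor_map phi.
Proof.
elim: n G => [G _ _|n IHn G].
  by exists (fun=> None); split; case.
have [N] := ubnP #|G|; elim: N => // N IHN in G * => ltN G0 dense.
have [/existsP[[x y] /andP[/= xy dense']]|nocontr] :=
  boolP [exists p : G * G, adj p.1 p.2 && (2 ^ n.+2 * #|contract p.1 p.2| <= narcs (contract p.1 p.2))].
  have cG := card_contract x y.
  have [||//|phi phiM] := IHN (contract x y).
  - by rewrite -ltnS cG.
  - by apply/card_gt0P; exists (contract_proj xy x).
  by exists (fun z => obind phi (Some (contract_proj xy z)));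
    apply: minor_map_comp phiM; apply: minor_map_contract.
(* A contraction falling below the required density loses more than [2 ^ n.+2] arcs, while
   [narcs_contract] bounds the loss by twice the number of common neighbours plus two. *)
have common (x y : G) : adj x y -> 2 ^ n.+1 <= #|[set z | adj x z && adj y z]|.
  move=> xy; have := narcs_contract xy; have := card_contract x y.
  move/existsPn: nocontr => /(_ (x, y)); rewrite /= xy /= -ltnNge => lt cG le.
  move: dense lt le; rewrite -cG mulnS !(expnS 2 n.+1) -muln2; nia.
have [x dx] : exists x : G, 0 < degree x.
  apply/existsP; rewrite -[[exists _, _]]negbK; apply/negP => /existsPn d0.
  have : narcs G = 0 by apply: big1 => x _; have := d0 x; lia.
  by have := expn_gt0 2 n.+2; nia.
pose W := [set y | adj x y].
have [|| phi [sP cP eP]] := IHn (induced W).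
- by rewrite card_induced.
- rewrite mulnC -sum_nat_const; apply: leq_sum => a _.
  rewrite degree_induced; have := valP a; rewrite inE => /common.
  by congr (_ <= _); apply: eq_card => z; rewrite !inE.
(* The vertex [x] is the new singleton branch set: it is adjacent to all of [W], which carries the
   model of [complete n]. *)
pose phi' z : option (complete n.+1) :=
  if z == x then Some ord0 else omap (lift ord0) (induced_map phi z).
have phx : phi' x = Some ord0 by rewrite /phi' eqxx.
have phW (a : induced W) i : phi a = Some i -> phi' (val a) = Some (lift ord0 i).
  move=> ai; rewrite /phi' induced_mapE ai; case: eqP => // ax.
  by have := valP a; rewrite inE ax adj_irr.
have ph0 z : phi' z = Some ord0 -> z = x.
  rewrite /phi'; case: eqP => // _; by case: (induced_map _ _).
have phS z i : phi' z = Some (lift ord0 i) -> exists2 a, z = val a & phi a = Some i.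
  rewrite /phi'; case: eqP => // _; case E: (induced_map _ _) => [j|//] /Some_inj/lift_inj ij; move: E.
  by rewrite ij; apply: induced_map_some.
exists phi'; split.
- move=> h; case: (unliftP ord0 h) => [i|] ->; last by exists x.
  by have [a /phW] := sP i; exists (val a).
- move=> h B; case: (unliftP ord0 h) => [i|] -> [u uh Bu] [v vh Bv]; last first.
    by move: Bv; rewrite (ph0 _ vh) -(ph0 _ uh) Bu.
  case: (phS _ _ uh) (phS _ _ vh) => [a ua ai] [b vb bi].
  have [|| c [d [ci di Bc Bd cd]]] := cP i (fun c => B (val c)).
  + by exists a; rewrite // -ua.
  + by exists b; rewrite // -vb.
  by exists (val c), (val d); split=> //; apply: phW.
- have aW (a : induced W) : adj x (val a) by have := valP a; rewrite inE.
  move=> h h'; case: (unliftP ord0 h) => [i|] ->; case: (unliftP ord0 h') => [j|] -> hh.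
  + have [|c [d [ci dj cd]]] := eP i j; first by move: hh; rewrite /= /complete_adj (inj_eq lift_inj).
    by exists (val c), (val d); split=> //; apply: phW.
  + by have [a ai] := sP i; exists (val a), x; rewrite (phW _ _ ai) adj_sym.
  + by have [a ai] := sP j; exists x, (val a); rewrite (phW _ _ ai).
  + by rewrite adj_irr in hh.
Qed.

(** The arc count of an induced subgraph, as a sum over a set so that deleting vertices does not
    change the type. *)
Definition set_arcs (G : sgraph) (W : {set G}) : nat :=
  \sum_(x in W) \sum_(y in W) adj x y.

Lemma set_arcs_sum_card (G : sgraph) (W : {set G}) :
  set_arcs W = \sum_(x in W) #|[set y in W | adj x y]|.
Proof.
apply: eq_bigr => x _; rewrite -sum1_card big_mkcond [RHS]big_mkcond /=.
by apply: eq_bigr => y _; rewrite inE; case: (y \in W); case: (adj x y).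
Qed.

Lemma narcs_induced (G : sgraph) (W : {set G}) : narcs (induced W) = set_arcs W.
Proof.
rewrite set_arcs_sum_card (reindex_omap (val : induced W -> G) insub) /=.
  rewrite /narcs; apply: eq_big => [a|a _]; last exact: degree_induced.
  by rewrite (valP a) valK eqxx.
by move=> x xW; rewrite insubT.
Qed.

Lemma set_arcsD1 (G : sgraph) (W : {set G}) v : v \in W ->
  set_arcs W = set_arcs (W :\ v) + (\sum_(y in W) adj v y).*2.
Proof.
move=> vW; rewrite /set_arcs (big_setD1 v) //=.
under [X in _ + X]eq_bigr => x _ do rewrite (big_setD1 v) //=.
rewrite big_split /= addnA addnC -addnn; congr (_ + (_ + _)).
rewrite [RHS](big_setD1 v) //= adj_irr.
by apply: eq_bigr => x _; rewrite adj_sym.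
Qed.

(* Deleting a vertex of minimum degree does not decrease the edge density. *)
Lemma dense_subset (G : sgraph) (W : {set G}) m : m <= #|W| ->
  exists2 W' : {set G}, #|W'| = m &
    set_arcs W * (m * m.-1) <= set_arcs W' * (#|W| * #|W|.-1).
Proof.
have [N] := ubnP #|W|; elim: N => // N IHN in W * => ltN.
rewrite leq_eqVlt => /orP[/eqP ->|ltm]; first by exists W.
have /card_gt0P[w wW] : 0 < #|W| by lia.
pose d v := \sum_(y in W) adj v y.
case: (arg_minnP d wW) => v /= vW' vmin; have vW : v \in W := vW'.
have cW := cardsD1 v W; rewrite vW in cW.
have dv : #|W| * d v <= set_arcs W by rewrite -sum_nat_const leq_sum.
have [||W' cW' le] := IHN (W :\ v); [lia | lia |].
exists W' => //.
move: le (set_arcsD1 vW) cW dv; rewrite -/(d v) /=.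
move: (set_arcs W) (set_arcs W') (set_arcs (W :\ v)) (d v) => a a'' a' e.
move: #|W| #|W :\ v| ltm => n1 n2 ltm le -> n1E dv.
rewrite {}n1E add1n /= in ltm dv *.
(* If the deletion leaves at most one vertex, then [m <= 1] and [m * m.-1] vanishes. *)
case: n2 => [|[|n2]] in le ltm dv *.
- by have -> : m = 0; [lia | rewrite mul0n muln0].
- by have -> : m * m.-1 = 0; [nia | rewrite muln0].
- rewrite -(@leq_pmul2l n2.+1) //=.
  (* The minimum degree [e] is at most the average, so [n2.+3 * e <= a' + e.*2]; this yields the
     comparison of densities for one deletion, with denominators cleared. *)
  have h : n2.+1 * (a' + e.*2) <= n2.+3 * a' by nia.
  have := leq_mul h (leqnn (m * m.-1)).
  have := leq_mul (leqnn n2.+3) le; rewrite /=; nia.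
Qed.

(** Each chosen vertex rules out at most [t] vertices, itself included since [adj] is irreflexive,
    so [n * t] vertices allow [n] choices. *)
Lemma greedy_clique (G : sgraph) (t n : nat) (W : {set G}) :
  0 < t -> (forall x : G, #|[set y | ~~ adj x y]| <= t) -> n * t <= #|W| ->
  exists A : {set G}, [/\ A \subset W, #|A| = n &
    {in A &, forall x y, x != y -> adj x y}].
Proof.
move=> t0 ht; elim: n W => [W _|n IHn W le].
  by exists set0; rewrite sub0set cards0; split=> // x y; rewrite inE.
have /card_gt0P[x xW] : 0 < #|W| by nia.
have cW : #|W :&: [set y | adj x y]| + #|W :\: [set y | adj x y]| = #|W|.
  exact: cardsID.
have cD : #|W :\: [set y | adj x y]| <= t.
  by apply: leq_trans (ht x); apply/subset_leq_card/subsetP => y; rewrite !inE => /andP[].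
have [|A [AW cA clA]] := IHn (W :&: [set y | adj x y]); first by nia.
have xA y : y \in A -> adj x y by move/(subsetP AW); rewrite !inE => /andP[].
exists (x |: A); split.
- by rewrite subUset sub1set xW (subset_trans AW) // subsetIl.
- rewrite cardsU1 cA; case: (boolP (x \in A)) => // /xA.
  by rewrite adj_irr.
- move=> y z; rewrite !inE => /orP[/eqP->|yA] /orP[/eqP->|zA] ne.
  + by rewrite eqxx in ne.
  + exact: xA.
  + by rewrite adj_sym xA.
  + exact: clA.
Qed.

(** * Complete models and added isolated vertices *)

Lemma minor_map_bij (G H : sgraph) (f : G -> H) : bijective f ->
  (forall x y, adj (f x) (f y) -> adj x y) -> minor_map (fun x => Some (f x)).
Proof.
move=> [g fK gK] fadj; split.
- by move=> h; exists (g h); rewrite gK.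
- by move=> h B [x [<-] Bx] [y [/(can_inj fK) ->]]; rewrite Bx.
- by move=> h h' hh; exists (g h), (g h'); rewrite !gK; split=> //; apply: fadj; rewrite !gK.
Qed.

Lemma minor_map_from_complete (F : sgraph) :
  minor_map (fun i : complete #|F| => Some (enum_val i : F)).
Proof.
apply: minor_map_bij; first exact: enum_val_bij.
by move=> i j /adj_neq; rewrite (inj_eq enum_val_inj).
Qed.

Lemma minor_map_to_complete (G : sgraph) n : #|G| = n ->
  (forall x y : G, x != y -> adj x y) ->
  exists phi : G -> option (complete n), minor_map phi.
Proof.
move=> <- clG; exists (fun x => Some (enum_rank x : complete #|G|)).
apply: minor_map_bij; first exact: enum_rank_bij.
by move=> x y; rewrite /= /complete_adj (inj_eq enum_rank_inj); apply: clG.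
Qed.

Lemma minor_map_add_isolated (F : sgraph) k (G : sgraph) (W : {set G})
    (phi : induced W -> option F) :
  minor_map phi -> #|W| + k <= #|G| ->
  exists psi : G -> option (add_isolated F k), minor_map psi.
Proof.
move=> [sP cP eP] le; pose s := enum (~: W).
have cs : k <= size s by rewrite -cardE -(leq_add2l #|W|) cardsC.
(* The first [k] vertices outside [W], in the order of [s], become the isolated ones; [insub] sends
   the later ones to [None]. *)
pose psi x : option (add_isolated F k) :=
  if x \in W then omap inl (induced_map phi x) else omap inr (insub (index x s)).
have psiW (a : induced W) f : phi a = Some f -> psi (val a) = Some (inl f).
  by move=> af; rewrite /psi (valP a) induced_mapE af.
have psiL x f : psi x = Some (inl f) -> exists2 a, x = val a & phi a = Some f.
  rewrite /psi; case: ifP => _; last by case: (insub _).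
  case E: (induced_map _ _) => [f'|//] [<-]; exact: induced_map_some.
have psiR x i : psi x = Some (inr i) -> x \in s /\ index x s = i.
  rewrite /psi; case: ifP => [_|xW]; first by case: (induced_map _ _).
  case: insubP => // j _ ji [<-]; split=> //.
  by rewrite mem_enum inE xW.
exists psi; split.
- move=> [f|i]; first by have [a /psiW] := sP f; exists (val a).
  have lti : i < size s by apply: leq_trans (ltn_ord i) cs.
  have [x0 _] : exists x0, x0 \in s.
    by case: (s) lti => // x0 s' _; exists x0; rewrite mem_head.
  exists (nth x0 s i).
  have := mem_nth x0 lti; rewrite mem_enum inE /psi => /negPf ->.
  rewrite index_uniq ?enum_uniq // insubT //= => lti'.
  by congr (Some (inr _)); apply: val_inj.
- move=> [f|i] B [x xh Bx] [y yh By]; last first.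
    case: (psiR _ _ xh) (psiR _ _ yh) => xs xi [ys yi].
    by move: By; rewrite -(nth_index x ys) yi -xi nth_index // Bx.
  case: (psiL _ _ xh) (psiL _ _ yh) => [a xa af] [b yb bf].
  have [|| c [d [cf df Bc Bd cd]]] := cP f (fun c => B (val c)).
  + by exists a; rewrite // -xa.
  + by exists b; rewrite // -yb.
  by exists (val c), (val d); split=> //; apply: psiW.
- move=> [f|i] [f'|i'] //= /eP[c [d [cf df cd]]].
  by exists (val c), (val d); split=> //; apply: psiW.
Qed.

Lemma has_minor_add_isolated (F : sgraph) k (G : sgraph) (W : {set G}) :
  (exists phi : induced W -> option (complete #|F|), minor_map phi) ->
  #|W| + k <= #|G| -> has_minor G (add_isolated F k).
Proof.
move=> [phi phiM] le.
have [psi psiM] := minor_map_add_isolated (minor_map_comp phiM (minor_map_from_complete F)) le.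
exact: has_minor_of_map psiM.
Qed.

(** In the bound on [k], with [c = 2 ^ #|F|.+1], the summand [#|F| * (3 * c + 1)] leaves room for
    the greedy clique when [m <= 3 * c], and the remaining [3 * c + 1] serves the density estimate
    when [m > 3 * c]. *)
Lemma min_degree_minor (F : sgraph) k (G : sgraph) :
  #|F| * (3 * 2 ^ #|F|.+1 + 1) + 3 * 2 ^ #|F|.+1 + 1 <= k ->
  0 < #|G| -> (forall x : G, #|F| + k - 1 <= degree x) ->
  has_minor G (add_isolated F k).
Proof.
set n := #|F|; set c := 2 ^ n.+1 => lek G0 deg.
have c0 : 0 < c by rewrite expn_gt0.
have codeg (x : G) : degree x + #|[set y | ~~ adj x y]| = #|G|.
  rewrite -(cardsC [set y | adj x y]); congr (_ + _).
  by apply: eq_card => y; rewrite !inE.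
have self (x : G) : 0 < #|[set y | ~~ adj x y]|.
  by apply/card_gt0P; exists x; rewrite inE adj_irr.
have geG : n + k <= #|G|.
  by have /card_gt0P[x _] := G0; have := codeg x; have := self x; have := deg x; lia.
pose m := #|G| - k.
have [lem|ltm] := leqP m (3 * c).
  (* The degree bound leaves each vertex at most [m - n + 1] non-neighbours, itself counted. *)
  have [|||A [_ cA clA]] := @greedy_clique G (m - n).+1 n setT.
  - by [].
  - by move=> x; have := codeg x; have := deg x; rewrite /m; lia.
  - rewrite cardsT; apply: leq_trans (_ : n * (3 * c + 1) <= _); last by lia.
    by rewrite leq_mul2l; apply/orP; right; lia.
  apply: (@has_minor_add_isolated F k G A); last by rewrite cA.
  apply: minor_map_to_complete; first by rewrite card_induced.
  by move=> a b ab; apply: clA; rewrite ?(valP a) ?(valP b).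
have [|W cW le] := @dense_subset G setT m; first by rewrite cardsT leq_subr.
apply: (@has_minor_add_isolated F k G W); last by rewrite cW /m; lia.
apply: complete_minor_map; first by rewrite card_induced cW; lia.
rewrite card_induced narcs_induced cW -/n -/c.
have arcsG : #|G| * (k - 1) <= set_arcs [set: G].
  rewrite set_arcs_sum_card -cardsT -sum_nat_const; apply: leq_sum => x _.
  apply: leq_trans (_ : degree x <= _); first by have := deg x; lia.
  by apply/subset_leq_card/subsetP => y; rewrite !inE.
(* Too few arcs in [W] would give [(k - 1) * m.-1 < c * #|G|.-1]. But two factors that are at least
   [3 * c] have a product at least [3 * c / 2] times their sum, and [#|G|.-1] exceeds that sum only
   by one. *)
rewrite leqNgt; apply/negP => lt.
move: le; rewrite cardsT => le.
have {le} : #|G| * (k - 1) * (m * m.-1) <= set_arcs W * (#|G| * #|G|.-1).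
  by apply: leq_trans le; rewrite leq_mul2r arcsG orbT.
rewrite [leqRHS]mulnCA -!mulnA leq_pmul2l // => le.
have m0 : 0 < m by lia.
have {}le : (k - 1) * (m * m.-1) < c * m * #|G|.-1.
  by apply: leq_ltn_trans le _; rewrite ltn_mul2r lt andbT; lia.
have {le} : (k - 1) * m.-1 < c * #|G|.-1.
  by rewrite -(ltn_pmul2l m0) mulnCA (leq_trans le) // mulnCA mulnA.
have -> : #|G|.-1 = m.-1 + (k - 1) + 1 by rewrite /m; lia.
have : 3 * c <= k - 1 by lia.
have : 3 * c <= m.-1 by lia.
move: (k - 1) m.-1 => K M; nia.
Qed.

(** * Degeneracy and list colouring *)

Lemma subgraph_trans (G H K : sgraph) : subgraph G H -> subgraph H K -> subgraph G K.
Proof.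
move=> [f [fi fa]] [g [gi ga]]; exists (g \o f); split; first exact: inj_comp.
by move=> x y /fa /ga.
Qed.

(** Greedy colouring: a vertex of degree at most [a] within [A] is coloured last, when at most [a]
    colours of its list are blocked. Colourings stay total, and only their properness is restricted
    to [A]. *)
Lemma degenerate_choosable (G : sgraph) a : degenerate a G -> choosable G a.+1.
Proof.
move=> degG C L hL.
suff H (A : {set G}) : exists c : G -> C, (forall x, c x \in L x) /\
    {in A &, forall x y, adj x y -> c x != c y}.
  have [c [cL cA]] := H setT; exists c; split=> // x y; exact: cA.
have [n] := ubnP #|A|; elim: n => // n IHn in A * => ltn.
have [A0|A0] := posnP #|A|.
  have ex x : exists a, a \in L x by apply/card_gt0P; apply: leq_trans (hL x).
  exists (fun x => xchoose (ex x)); split=> [x|x y]; first exact: xchooseP.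
  by rewrite (cards0_eq A0) inE.
have [|x] := degG _ (induced_subgraph A); first by rewrite card_induced.
rewrite degree_induced; set N := [set y in A | _] => dx.
have [|c [cL cA]] := IHn (A :\ val x).
  by have := cardsD1 (val x) A; rewrite (valP x); lia.
have /subsetPn[b bL bN] : ~~ (L (val x) \subset c @: N).
  apply/negP => /subset_leq_card; have := leq_imset_card c N; have := hL (val x); lia.
have bc y : y \in A -> adj (val x) y -> b != c y.
  by move=> yA xy; apply: contraNneq bN => ->; rewrite imset_f // inE yA.
exists (fun y => if y == val x then b else c y); split=> [y|y z yA zA yz].
  by case: eqP => [->|].
case: (eqVneq y (val x)) => [yx|yx]; case: (eqVneq z (val x)) => [zx|zx].
- by rewrite yx zx adj_irr in yz.
- by apply: bc => //; rewrite -yx.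
- by rewrite eq_sym; apply: bc => //; rewrite -zx adj_sym.
- by apply: cA => //; rewrite !inE ?yx ?zx.
Qed.

(** * Choice numbers and the extremal complete graph *)

Lemma choice_number_le (G : sgraph) k : choosable G k -> choice_number G <= k.
Proof. by move=> /asboolP chk; rewrite /choice_number; case: ex_minnP => j _; apply. Qed.

Lemma choice_number_complete m : choice_number (complete m) = m.
Proof.
apply/eqP; rewrite eqn_leq; apply/andP; split.
  by rewrite -{2}(card_ord m); apply/choice_number_le/(@choosable_order (complete m)).
rewrite /choice_number; case: ex_minnP => k /asboolP chk _.
(* With all lists equal to ['I_k], a proper colouring of the complete graph injects its [m] vertices
   into ['I_k]. *)
have [|c [_ cP]] := chk 'I_k (fun=> setT); first by rewrite cardsT card_ord.
have ci : injective c.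
  by move=> x y cxy; apply/eqP; apply: contraTT (eqxx (c x)) => xy; rewrite {2}cxy cP.
by have := leq_card c ci; rewrite !card_ord.
Qed.

(** Neither passing to a subgraph nor contracting adds vertices; hence a complete graph with fewer
    vertices than [H] is [H]-minor-free. *)
Lemma has_minor_card (G H : sgraph) : has_minor G H -> #|H| <= #|G|.
Proof.
move=> [S [K [[f [fi _]] SK [g [gb _]]]]]; rewrite -(bij_eq_card gb).
apply: leq_trans (leq_card f fi).
elim: SK => // S' x y K' _ _ le.
by rewrite -(card_contract x y); apply: leqW.
Qed.

Theorem theorem1p3 (F : sgraph) :
  exists k0 : nat, forall k : nat, k0 <= k ->
    max_choice_number (add_isolated F k) (#|add_isolated F k| - 1) /\
    (forall G : sgraph, minor_free (add_isolated F k) G ->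
       degenerate (#|add_isolated F k| - 2) G).
Proof.
exists (#|F| * (3 * 2 ^ #|F|.+1 + 1) + 3 * 2 ^ #|F|.+1 + 1) => k lek.
(* Positivity of the power forces [k >= 2], so the truncated subtractions of 1 and 2 are exact. *)
have c0 : 0 < 2 ^ #|F|.+1 by rewrite expn_gt0.
have cH : #|add_isolated F k| = #|F| + k by rewrite card_sum card_ord.
have degen G : minor_free (add_isolated F k) G -> degenerate (#|add_isolated F k| - 2) G.
  (* In a subgraph [S] violating degeneracy all degrees are at least [#|F| + k - 1]; the minor found
     in [S] is also one of [G]. *)
  move=> freeG S SG S0; apply: contrapT => /forallNP deg; apply: freeG.
  have [|T [K [TS TK KH]]] := min_degree_minor lek S0.
    by move=> x; have /negP := deg x; rewrite cH; lia.
  by exists T, K; split=> //; apply: subgraph_trans TS SG.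
split=> //; split.
  exists (complete (#|add_isolated F k| - 1)); split; last exact: choice_number_complete.
  by move/has_minor_card; rewrite card_ord cH; lia.
move=> G /degen /degenerate_choosable /choice_number_le; rewrite cH; lia.
Qed.
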